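(* Let $\mathbf{G}=(\mathbf{E},\mathbf{V})$ be a network with vertices $v_1,\dots,v_N$ and let $P\ge 1$. For all cluster centers $x_1,x_2,\dots,x_P\in\mathbf{G}$ there exist vertices $v_{m_1},v_{m_2},\dots,v_{m_P}\in\mathbf{V}$ such that $$\sum_{k=1}^P\sum_{i=1}^N p_{ik}^2\,d(v_i,x_k)\ \ge\ \sum_{k=1}^P\sum_{i=1}^N q_{ik}^2\,d(v_i,v_{m_k}),$$ where $(p_{ik})$ are the optimal Probabilistic Distance Clustering memberships for the centers $x_1,\dots,x_P$ and $(q_{ik})$ are the optimal memberships for the centers $v_{m_1},\dots,v_{m_P}$.
   Context: A network $\mathbf{G}=(\mathbf{E},\mathbf{V})$ is a finite, undirected, connected graph with vertex set $\mathbf{V}=\{v_1,\dots,v_N\}$ and edge set $\mathbf{E}$, in which each edge $e$ has a strictly positive length. Each edge is identified with a segment of its length, so that ''points of $\mathbf{G}$'' means vertices as well as interior points of edges, and $d(\cdot,\cdot)$ is the shortest path distance between points of $\mathbf{G}$. The Probabilistic Distance Clustering problem with $P$ clusters minimizes $\sum_{i=1}^N\sum_{k=1}^P p_{ik}^2\,d(v_i,x_k)$ over centers $x_1,\dots,x_P\in\mathbf{G}$ and memberships $p_{ik}\ge 0$ with $\sum_{k=1}^P p_{ik}=1$ for all $i$. For given centers, optimal memberships are memberships minimizing this sum with the centers held fixed; when all distances are positive they are $p_{ik}=\Bigl(\sum_{l=1}^P \frac{d(v_i,x_k)}{d(v_i,x_l)}\Bigr)^{-1}$. The vertices $v_{m_1},\dots,v_{m_P}$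 are not required to be distinct. *)

(* Defs.v *)
From HB Require Import structures.
From mathcomp Require Import all_boot all_order all_algebra.
From mathcomp Require Import classical_sets reals.
Set Implicit Arguments.
Unset Strict Implicit.
Unset Printing Implicit Defensive.
Import Order.TTheory GRing.Theory Num.Theory.
Local Open Scope ring_scope.

(* The orientation from [src e] to [tgt e] is arbitrary: it only fixes a
   coordinate t in [0, len e] along the segment e, t = 0 being the end [src e].
   Adjacency, and hence the network, is undirected.  Parallel edges and loops
   are allowed. *)
Definition adjacent (V E : finType) (src tgt : E -> V) : rel V :=
  fun u v => [exists e, (src e == u) && (tgt e == v)
                     || (src e == v) && (tgt e == u)].

Record network (R : realType) := Network {
  vertex : finType;
  edge : finType;
  src : edge -> vertex;
  tgt : edge -> vertex;
  len : edge -> R;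
  len_gt0 : forall e, 0 < len e;
  network_connected : forall u v, connect (adjacent src tgt) u v }.

Inductive netpoint (R : realType) (G : network R) :=
| Vertex of vertex G
| Interior (e : edge G) (t : R) of 0 < t < len e.

(* [x] is the point of the closed segment [e] with coordinate [t].  The two
   ends of a loop are the same vertex, which then has two coordinates. *)
Definition on_edge (R : realType) (G : network R)
    (e : edge G) (t : R) (x : netpoint G) : Prop :=
  match x with
  | Vertex v => (t = 0 /\ v = src e) \/ (t = len e /\ v = tgt e)
  | Interior e' t' _ => e' = e /\ t' = t
  end.

(* [walk x y l]: some path of total length [l] leads from [x] to [y], each of
   its pieces being a subsegment of a single edge. *)
Inductive walk (R : realType) (G : network R) :
    netpoint G -> netpoint G -> R -> Prop :=
| walk_nil x : walk x x 0
| walk_cons x y z e s t l :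
    on_edge e s x -> on_edge e t y -> walk y z l -> walk x z (`|s - t| + l).

Definition dist (R : realType) (G : network R) (x y : netpoint G) : R :=
  inf [set l | walk x y l]%classic.

Definition pdc_cost (R : realType) (G : network R) (P : nat)
    (x : 'I_P -> netpoint G) (p : vertex G -> 'I_P -> R) : R :=
  \sum_(v : vertex G) \sum_(k < P) p v k ^+ 2 * dist (Vertex v) (x k).

Definition memberships (R : realType) (G : network R) (P : nat)
    (p : vertex G -> 'I_P -> R) : Prop :=
  (forall v k, 0 <= p v k) /\ (forall v, \sum_(k < P) p v k = 1).

Definition optimal_memberships (R : realType) (G : network R) (P : nat)
    (x : 'I_P -> netpoint G) (p : vertex G -> 'I_P -> R) : Prop :=
  memberships p /\
  forall p' : vertex G -> 'I_P -> R,
    memberships p' -> pdc_cost x p <= pdc_cost x p'.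

(* Main.v *)
Require Import Defs.
From HB Require Import structures.
From mathcomp Require Import all_boot all_order all_algebra.
From mathcomp Require Import classical_sets reals.
From mathcomp Require Import boolp lra.
Set Implicit Arguments.
Unset Strict Implicit.
Unset Printing Implicit Defensive.
Import Order.TTheory GRing.Theory Num.Theory.
Local Open Scope ring_scope.

(** Fix a vertex v and let F interpolate d(v, .) affinely along each edge from
    its values at the two ends.  Those values differ by at most the length of
    the edge, so F grows by at most l along a path of length l, and
    F <= d(v, .).  Hence, for weights w_v >= 0 and a point x of an edge [a, b],
    the sum of w_v d(v, x) is at least a convex combination of the same sums
    with a and b in place of x, and thus at least one of them.  With
    w_v = p_vk^2, this moves every center to a vertex while keeping the
    memberships p fixed; passing to the optimal q only lowers the cost. *)

Section Dist.
Variables (R : realType) (G : network R).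
Implicit Types (x y z : netpoint G) (u v : vertex G) (e : edge G).

Lemma walk_ge0 x y l : walk x y l -> 0 <= l.
Proof. by elim=> // *; rewrite addr_ge0. Qed.

(** [walk_cons] extends a walk at its start; distances from a fixed vertex need extension at the far
    end. *)
Lemma walk_rcons x y z e s t l :
  walk x y l -> on_edge e s y -> on_edge e t z -> walk x z (l + `|s - t|).
Proof.
move=> w; elim: w z e s t => {x y l} [x|x y y' f a b l xa yb _ IH] z e s t es et.
  by rewrite addrC; apply: walk_cons es et _; apply: walk_nil.
by rewrite -addrA; apply: walk_cons xa yb _; apply: IH es et.
Qed.

Lemma on_edge_src e : on_edge e 0 (Vertex (src e)).
Proof. by left. Qed.

Lemma on_edge_tgt e : on_edge e (len e) (Vertex (tgt e)).
Proof. by right. Qed.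

Lemma walk_vertices u v : exists l, walk (Vertex u) (Vertex v) l.
Proof.
have /connectP[p + ->] := network_connected u v.
elim: p u => [|w p IH] u /=; first by exists 0; apply: walk_nil.
case/andP=> /existsP[e /orP[]/andP[/eqP <- /eqP <-]] /IH[l wl].
- by eexists; apply: walk_cons (on_edge_src e) (on_edge_tgt e) wl.
- by eexists; apply: walk_cons (on_edge_tgt e) (on_edge_src e) wl.
Qed.

(** Keeps the set of lengths in [dist] nonempty, so that its [inf] is a true greatest lower bound
    and not a default value. *)
Lemma walk_from_vertex v y : exists l, walk (Vertex v) y l.
Proof.
case: y => [u|e t te]; first exact: walk_vertices.
have [l w] := walk_vertices v (src e).
eexists; apply: walk_rcons w (on_edge_src e) _.
by split.
Qed.

Lemma dist_le_walk x y l : walk x y l -> dist x y <= l.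
Proof. by move=> w; apply: ge_inf => //; exists 0 => m /walk_ge0. Qed.

Lemma le_dist v y c :
  (forall l, walk (Vertex v) y l -> c <= l) -> c <= dist (Vertex v) y.
Proof. by move=> h; apply: lb_le_inf => //; apply: walk_from_vertex. Qed.

Lemma dist_on_edge v e s t x y : on_edge e s x -> on_edge e t y ->
  dist (Vertex v) y <= dist (Vertex v) x + `|s - t|.
Proof.
move=> ex ey; rewrite -lerBlDr; apply: le_dist => l w.
by rewrite lerBlDr; apply: dist_le_walk; apply: walk_rcons w ex ey.
Qed.

Lemma dist_src_tgt v e :
  `|dist (Vertex v) (Vertex (tgt e)) - dist (Vertex v) (Vertex (src e))|
    <= len e.
Proof.
have h1 := dist_on_edge v (on_edge_src e) (on_edge_tgt e).
have h2 := dist_on_edge v (on_edge_tgt e) (on_edge_src e).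
move: h1 h2; rewrite sub0r subr0 normrN (gtr0_norm (len_gt0 e)) => h1 h2.
by rewrite ler_norml; apply/andP; split; lra.
Qed.

Definition edge_interp v e (t : R) : R :=
  dist (Vertex v) (Vertex (src e))
  + t / len e * (dist (Vertex v) (Vertex (tgt e))
                 - dist (Vertex v) (Vertex (src e))).

Definition point_interp v x : R :=
  match x with
  | Vertex u => dist (Vertex v) (Vertex u)
  | Interior e t _ => edge_interp v e t
  end.

(** A vertex has a coordinate on each edge ending there, two on a loop; the interpolation takes the
    true distance at both ends of an edge, so all these coordinates give one value. *)
Lemma point_interp_on_edge v e t x :
  on_edge e t x -> point_interp v x = edge_interp v e t.
Proof.
rewrite /edge_interp; case: x => [u|e' t' t'e] /=; last by case=> -> ->.
case=> -[-> ->]; first by rewrite mul0r mul0r addr0.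
by rewrite divff ?gt_eqF ?len_gt0// mul1r addrC subrK.
Qed.

(** By [dist_src_tgt], the slope along [e] is at most 1 in absolute value. *)
Lemma edge_interp_lip v e s t :
  edge_interp v e t <= edge_interp v e s + `|s - t|.
Proof.
rewrite -lerBlDl /edge_interp opprD addrACA subrr add0r -mulrBl -mulrBl.
apply: le_trans (ler_norm _) _; rewrite !normrM distrC -mulrA ler_piMr//.
rewrite normfV (gtr0_norm (len_gt0 e)) mulrC ler_pdivrMr ?len_gt0// mul1r.
exact: dist_src_tgt.
Qed.

Lemma point_interp_walk v x y l :
  walk x y l -> point_interp v y <= point_interp v x + l.
Proof.
elim=> {x y l} [x|x y z e s t l ex ey _ IH]; first by rewrite addr0.
apply: le_trans IH _; rewrite addrA lerD2r.
rewrite (point_interp_on_edge v ex) (point_interp_on_edge v ey).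
exact: edge_interp_lip.
Qed.

Lemma point_interp_le_dist v y : point_interp v y <= dist (Vertex v) y.
Proof.
apply: le_dist => l /(point_interp_walk v) /le_trans; apply.
(* The growth bound starts at [v] itself, where the interpolation is at most 0 by the empty walk. *)
by rewrite gerDr; apply: dist_le_walk; apply: walk_nil.
Qed.

Lemma weighted_dist_vertex (w : vertex G -> R) x : (forall v, 0 <= w v) ->
  exists u, \sum_v w v * dist (Vertex v) (Vertex u)
            <= \sum_v w v * dist (Vertex v) x.
Proof.
move=> w0; case: x => [u|e t te]; first by exists u.
pose S u := \sum_v w v * dist (Vertex v) (Vertex u).
pose c := t / len e.
have c0 : 0 <= c by case/andP: te => t0 _; rewrite divr_ge0 ?ltW ?len_gt0.
have c1 : c <= 1.
  by case/andP: te => _ tl; rewrite ler_pdivrMr ?len_gt0// mul1r ltW.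
have H : S (src e) + c * (S (tgt e) - S (src e))
         <= \sum_v w v * dist (Vertex v) (Interior te).
  rewrite /S -sumrB mulr_sumr -big_split; apply: ler_sum => v _ /=.
  rewrite -mulrBr mulrCA -mulrDr ler_wpM2l//.
  exact: (point_interp_le_dist v (Interior te)).
have [h|h] := leP (S (src e)) (S (tgt e)).
- by exists (src e); apply: le_trans H; rewrite lerDl mulr_ge0// subr_ge0.
(* The gap is [(1 - c) * (S (src e) - S (tgt e))], a product of nonnegative factors. *)
- by exists (tgt e); apply: le_trans H; rewrite -/(S _); nra.
Qed.

End Dist.

Theorem theorem4p5 (R : realType) (G : network R) (P : nat) (hP : (1 <= P)%N)
    (x : 'I_P -> netpoint G) :
  exists m : 'I_P -> vertex G,
    forall p q : vertex G -> 'I_P -> R,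
      optimal_memberships x p ->
      optimal_memberships (fun k => Vertex (m k)) q ->
      \sum_(k < P) \sum_(v : vertex G) p v k ^+ 2 * dist (Vertex v) (x k)
      >= \sum_(k < P) \sum_(v : vertex G)
           q v k ^+ 2 * dist (Vertex v) (Vertex (m k)).
Proof.
have vertex_near (w : vertex G -> 'I_P -> R) : exists m : 'I_P -> vertex G,
    forall k, \sum_v w v k ^+ 2 * dist (Vertex v) (Vertex (m k))
              <= \sum_v w v k ^+ 2 * dist (Vertex v) (x k).
  have h k := weighted_dist_vertex (x k) (fun v => sqr_ge0 (w v k)).
  have [m mP] := choice h; by exists m.
(* [m] may depend on one optimal [p0] only: all optimal [p] have its cost. *)
have [[p0 [p0M p0min]]|no_opt] := EM (exists p, optimal_memberships x p).
- have [m mP] := vertex_near p0; exists m => p q [pM _] [_ qmin].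
  (* In terms of [pdc_cost], the chain is: [q] at [m], then [p0] at [m], then [p0] at [x], then [p]
     at [x]. *)
  rewrite exchange_big [leRHS]exchange_big /=.
  apply: le_trans (qmin _ p0M) _.
  suff: pdc_cost (fun k => Vertex (m k)) p0 <= pdc_cost x p0.
    by move=> /le_trans; apply; apply: p0min.
  rewrite /pdc_cost exchange_big [leRHS]exchange_big /=.
  by apply: ler_sum => k _; apply: mP.
(* The claim is vacuous here, but some [m] must still be given; zero weights supply one. *)
- have [m _] := vertex_near (fun _ _ => 0); exists m => p q pO.
  by case: no_opt; exists p.
Qed.
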